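(* Let $G=(V,E)$ be a finite connected weighted graph, let $T>0$, and let $f:V\times[0,T]\times\mathbb{R}\to\mathbb{R}$ and $u_0:V\to\mathbb{R}$ be given. Consider the problem $$u_t-\Delta_V u=f(x,t,u)\ \text{ on }V\times(0,T],\qquad u(x,0)=u_0(x)\ \text{ on }V.\quad (P)$$ Let $\overline{u}$ and $\underline{u}$ be an upper and a lower solution of (P), respectively, and set $\underline{\eta}=\min_{V\times[0,T]}\min\{\overline{u},\underline{u}\}$ and $\overline{\eta}=\max_{V\times[0,T]}\max\{\overline{u},\underline{u}\}$. Suppose that for every $x\in V$ the function $f(x,t,z)$ is continuous with respect to $(t,z)\in[0,T]\times[\underline{\eta},\overline{\eta}]$, and that there is a constant $M>0$ with $$|f(x,t,u)-f(x,t,v)|\le M|u-v|\quad\text{for all }(x,t)\in V\times(0,T],\ u,v\in[\underline{\eta},\overline{\eta}].$$ Then (P) admits a unique solution $u\in C^1(V\times[0,T])$ satisfying $\underline{u}\le u\le\overline{u}$ on $V\times[0,T]$.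
   Context: $G=(V,E)$ is a finite, undirected, connected graph with a weight $\omega:V\times V\to[0,\infty)$, $\omega_{xy}=\omega_{yx}$, $\omega_{xy}=0$ if and only if $xy\notin E$, and a measure $\mu:V\to(0,\infty)$. The graph Laplacian is $\Delta_V u(x)=\sum_{y\in V}(u(y)-u(x))\frac{\omega_{yx}}{\mu(x)}$ (acting in $x$). For an interval $I$, $u\in C^1(V\times I)$ means that $u(x,\cdot)$ is continuously differentiable on $I$ for each $x\in V$ (one-sided at included endpoints). An upper (respectively lower) solution of (P) is a function $u\in C^1(V\times[0,T])$ with $u_t-\Delta_V u\ge(\le)\,f(x,t,u)$ on $V\times(0,T]$ and $u(x,0)\ge(\le)\,u_0(x)$ on $V$. *)

(* Defs.v *)
From HB Require Import structures.
From mathcomp Require Import all_boot all_order all_algebra.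
From mathcomp Require Import all_classical all_reals all_analysis.
Set Implicit Arguments.
Unset Strict Implicit.
Unset Printing Implicit Defensive.
Import Order.TTheory GRing.Theory Num.Theory.
Import numFieldNormedType.Exports.
Local Open Scope classical_set_scope.
Local Open Scope ring_scope.

(* Loops are not excluded: a term [x = y] contributes nothing to the
   Laplacian below. *)
Record connected_weighted_graph (R : realType) (V : finType) := ConnectedWeightedGraph {
  edge : rel V;
  edge_sym : symmetric edge;
  edge_connected : forall x y : V, connect edge x y;
  weight : V -> V -> R;
  weight_ge0 : forall x y : V, 0 <= weight x y;
  weight_sym : forall x y : V, weight x y = weight y x;
  weight_eq0 : forall x y : V, weight x y = 0 <-> ~~ edge x y;
  vmeasure : V -> R;
  vmeasure_gt0 : forall x : V, 0 < vmeasure x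
}.

Definition laplacian (R : realType) (V : finType) (G : connected_weighted_graph R V)
    (u : V -> R) (x : V) : R :=
  \sum_(y : V) (u y - u x) * (weight G y x / vmeasure G x).

(* Functions on [V * `[0, T]] are represented by total functions [V -> R -> R];
   their values at times outside [`[0, T]] are never used. In particular
   derivatives are taken along [`[0, T]], hence are one-sided at endpoints. *)
Definition diff_quotient (R : realType) (g : R -> R) (t s : R) : R :=
  (g s - g t) / (s - t).

Definition derivable_within (R : realType) (I : set R) (g : R -> R) (t : R) :=
  cvg (diff_quotient g t s @[s --> within I t^']).

Definition derive_within (R : realType) (I : set R) (g : R -> R) (t : R) : R :=
  lim (diff_quotient g t s @[s --> within I t^']).

Definition C1 (R : realType) (V : Type) (I : set R) (u : V -> R -> R) : Prop :=
  forall x : V,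
    (forall t, I t -> derivable_within I (u x) t) /\
    {within I, continuous (derive_within I (u x))}.

Section problem.
Variables (R : realType) (V : finType) (G : connected_weighted_graph R V) (T : R).
Variables (f : V -> R -> R -> R) (u0 : V -> R).

Definition heat_op (u : V -> R -> R) (x : V) (t : R) : R :=
  derive_within `[0, T] (u x) t - laplacian G (u ^~ t) x.

Definition solution (u : V -> R -> R) : Prop :=
  [/\ C1 `[0, T] u,
      forall x t, 0 < t <= T -> heat_op u x t = f x t (u x t)
    & forall x, u x 0 = u0 x].

Definition upper_solution (u : V -> R -> R) : Prop :=
  [/\ C1 `[0, T] u,
      forall x t, 0 < t <= T -> heat_op u x t >= f x t (u x t)
    & forall x, u x 0 >= u0 x].

Definition lower_solution (u : V -> R -> R) : Prop :=
  [/\ C1 `[0, T] u,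
      forall x t, 0 < t <= T -> heat_op u x t <= f x t (u x t)
    & forall x, u x 0 <= u0 x].

End problem.

(* The infimum and the supremum below are attained for C^1 functions:
   see [eta_min_attained] and [eta_max_attained]. *)
Definition eta_min (R : realType) (V : finType) (T : R) (v w : V -> R -> R) : R :=
  inf [set Num.min (v p.1 p.2) (w p.1 p.2) | p in [set: V] `*` `[0, T]].

Definition eta_max (R : realType) (V : finType) (T : R) (v w : V -> R -> R) : R :=
  sup [set Num.max (v p.1 p.2) (w p.1 p.2) | p in [set: V] `*` `[0, T]].

Lemma derivable_within_continuous (R : realType) (I : set R) (g : R -> R) :
  (forall t, I t -> derivable_within I g t) -> {within I, continuous g}.
Proof.
move=> dg; apply/subspace_continuousP => t It.
have cvg_punctured : g s @[s --> within I t^'] --> g t.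
  have cvg_sub : (s - t) @[s --> within I t^'] --> t - t.
    have cvg_sub0 : (s - t) @[s --> t] --> t - t.
      by apply: cvgB; [exact: cvg_id | exact: (@cvg_cst R)].
    by apply: cvg_trans cvg_sub0 => A tA; apply: filterS (nbhs_dnbhs tA) => s + _.
  have cvg_expansion : (g t + diff_quotient g t s * (s - t))
      @[s --> within I t^'] --> g t + derive_within I g t * (t - t).
    by apply: cvgD; [exact: (@cvg_cst R) | apply: cvgM => //; exact: dg].
  rewrite subrr mulr0 addr0 in cvg_expansion.
  apply: cvg_trans cvg_expansion; apply: near_eq_cvg.
  rewrite near_withinE; near=> s => _.
  rewrite /diff_quotient divfK ?subrKC //.
  by rewrite subr_eq0; near: s; exact: nbhs_dnbhs_neq.
move=> A gtA; have := cvg_punctured A gtA.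
rewrite /= !nbhs_simpl /within /= /dnbhs /within /= => H.
near=> s => Is; have [->|st] := eqVneq s t; first exact: nbhs_singleton.
by move: st Is; near: s; exact: H.
Unshelve. all: by end_near. Qed.

Section attained.
Variables (R : realType) (V : finType) (T : R).
Hypotheses (V_gt0 : (0 < #|V|)%N) (T_ge0 : 0 <= T).
Let D : set (V * R) := [set: V] `*` `[0, T].

Lemma inf_attained (h : V * R -> R) :
  (forall x, {within `[0, T], continuous (fun t => h (x, t))}) ->
  exists2 p, D p & h p = inf [set h p | p in D].
Proof.
move=> hc; have [x0 _] := card_gt0P V_gt0.
have minx x : {c | c \in `[0, T] &
    forall t, t \in `[0, T] -> h (x, c) <= h (x, t)}.
  by apply: cid2; exact: (EVT_min T_ge0 (hc x)).
pose c x := s2val (minx x).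
have cI x : c x \in `[0, T] := s2valP (minx x).
have cmin x t : t \in `[0, T] -> h (x, c x) <= h (x, t) := s2valP' (minx x) t.
have [x _ xmin] := @Order.TotalTheory.arg_minP _ R V x0 predT
  (fun x => h (x, c x)) isT.
have lb : lbound [set h p | p in D] (h (x, c x)).
  by move=> _ [[y t] [_ /= tI] <-]; apply: (le_trans (xmin y isT)); exact: cmin.
exists (x, c x); first by split => //=; exact: cI.
apply/eqP; rewrite eq_le; apply/andP; split.
  by apply: lb_le_inf lb; exists (h (x, c x)), (x, c x) => //; split => //=; exact: cI.
apply: ge_inf; first by exists (h (x, c x)).
by exists (x, c x) => //; split => //=; exact: cI.
Qed.

Lemma sup_attained (h : V * R -> R) :
  (forall x, {within `[0, T], continuous (fun t => h (x, t))}) ->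
  exists2 p, D p & h p = sup [set h p | p in D].
Proof.
move=> hc.
have [|p Dp hp] := @inf_attained (fun p => - h p).
  by move=> x t; apply: cvgN; exact: hc.
exists p => //; apply: oppr_inj; rewrite hp /inf; congr (- sup _).
by rewrite image_comp; apply: eq_imagel => q _ /=; rewrite opprK.
Qed.

Variables v w : V -> R -> R.
Hypotheses (vC1 : C1 `[0, T] v) (wC1 : C1 `[0, T] w).

Lemma eta_min_attained : exists2 p, D p &
  Num.min (v p.1 p.2) (w p.1 p.2) = eta_min T v w.
Proof.
apply: inf_attained => x t /=; apply: (@continuous_min R (subspace `[0, T])).
- exact: derivable_within_continuous (vC1 x).1 t.
- exact: derivable_within_continuous (wC1 x).1 t.
Qed.

Lemma eta_max_attained : exists2 p, D p &
  Num.max (v p.1 p.2) (w p.1 p.2) = eta_max T v w.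
Proof.
apply: sup_attained => x t /=; apply: (@continuous_max R (subspace `[0, T])).
- exact: derivable_within_continuous (vC1 x).1 t.
- exact: derivable_within_continuous (wC1 x).1 t.
Qed.

End attained.

(* Main.v *)
Require Import Defs.
From HB Require Import structures.
From mathcomp Require Import all_boot all_order all_algebra.
From mathcomp Require Import all_classical all_reals all_analysis.
From mathcomp Require Import ring lra.
Set Implicit Arguments.
Unset Strict Implicit.
Unset Printing Implicit Defensive.
Import Order.TTheory GRing.Theory Num.Theory.
Import numFieldNormedType.Exports.
Local Open Scope classical_set_scope.
Local Open Scope ring_scope.

(** The idea is to trade the local hypotheses on [f] for global ones, solve the
    resulting ODE system on the finite vertex set, and let a comparison
    principle show that the modification was invisible.

    Write [m] and [k] for the minimum and maximum of the two barriers, and set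
    [F x t z = f x (clamp 0 T t) (clamp m k z)]. Since clamping is continuous
    and 1-Lipschitz, [F] is continuous in time along continuous functions and
    [M]-Lipschitz in all real [z] at positive times up to [T], and it agrees
    with [f] on [0, T] wherever [z] lies between [m] and [k]. On a finite graph the Laplacian is a bounded linear
    map ([laplacian_lipschitz]), so [u_t = laplacian u + F(x, t, u)] is an ODE
    with Lipschitz right-hand side and has a solution by Picard iteration
    ([picard], [exists_solution]). As the right-hand side makes sense at all
    real times, the iteration runs with genuine two-sided derivatives, and
    one-sided ones appear only when the result is restricted to [0, T]
    ([is_derive_within]).

    The comparison principle [lower_le_upper] says that a lower solution stays
    below an upper one as soon as the nonlinearity is Lipschitz. The barriers
    take values in [m, k], so they are also barriers for [F]; comparing with
    them traps the solution [u] between them, hence in [m, k], where [F] is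
    [f]. Conversely a solution for [f] trapped between the barriers is one for
    [F], and comparing it with [u] both ways gives uniqueness. *)

(** * Derivatives along a compact interval *)

Lemma cvg_diff_quotient (R : realType) (g : R -> R) (t d : R) :
  is_derive t 1 g d -> diff_quotient g t s @[s --> t^'] --> d.
Proof.
move=> /is_derive1_caratheodory [q [gE qc <-]].
apply: (@cvg_trans _ (q @ t^')); last exact: cvg_within_filter.
apply: near_eq_cvg; near=> s; rewrite /diff_quotient gE mulfK// subr_eq0.
by near: s; exact: nbhs_dnbhs_neq.
Unshelve. all: by end_near. Qed.

Lemma at_left_within (R : realType) (T t : R) :
  0 < t <= T -> t^'- `=>` within `[0, T] t^'.
Proof.
move=> /andP[t0 tT] A tA.
have {}tA : \forall s \near t, s != t -> s \in `[0, T] -> A s by exact: tA.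
rewrite /at_left /within /=; near=> s => st; move: (lt_eqF st) => /negbT st'.
suff : s != t -> s \in `[0, T] -> A s.
  apply=> //; rewrite in_itv/= (le_trans (ltW st))// andbT ltW//.
  by near: s; exact: lt_nbhsr.
by near: s.
Unshelve. all: by end_near. Qed.

Lemma at_right_within (R : realType) (T t : R) :
  0 <= t < T -> t^'+ `=>` within `[0, T] t^'.
Proof.
move=> /andP[t0 tT] A tA.
have {}tA : \forall s \near t, s != t -> s \in `[0, T] -> A s by exact: tA.
rewrite /at_right /within /=; near=> s => st; move: (gt_eqF st) => /negbT st'.
suff : s != t -> s \in `[0, T] -> A s.
  apply=> //; rewrite in_itv/= (le_trans t0 (ltW st))/= ltW//.
  by near: s; exact: lt_nbhsl.
by near: s.
Unshelve. all: by end_near. Qed.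

(** Limits along [0, T] at a point of [0, T] are unique: the point is
    approachable from the right, or, at the final time, from the left. *)
Lemma within_itv_proper (R : realType) (T t : R) :
  0 < T -> 0 <= t <= T -> ProperFilter (within `[0, T] t^').
Proof.
move=> T0 /andP[t0 tT]; split; last exact: within_filter.
have [tT'|Tt] := ltP t T.
  by move=> /(@at_right_within _ T t); rewrite t0 tT' => /(_ isT)/filter_not_empty.
have t0' : 0 < t <= T by rewrite (lt_le_trans T0).
by move=> /(@at_left_within _ T t t0')/filter_not_empty.
Qed.

Lemma is_derive_within (R : realType) (T : R) (g : R -> R) (t d : R) :
  0 < T -> 0 <= t <= T -> is_derive t 1 g d ->
  derivable_within `[0, T] g t /\ derive_within `[0, T] g t = d.
Proof.
move=> T0 tT /cvg_diff_quotient gd.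
have PF := @within_itv_proper R T t T0 tT.
have {}gd : diff_quotient g t s @[s --> within `[0, T] t^'] --> d.
  by apply: cvg_trans gd; apply: cvg_app; exact: cvg_within.
split; first by apply/cvg_ex; exists d.
exact: cvg_lim gd.
Qed.

Lemma derive_within_at_left (R : realType) (T : R) (g : R -> R) (t : R) :
  0 < t <= T -> derivable_within `[0, T] g t ->
  diff_quotient g t s @[s --> t^'-] --> derive_within `[0, T] g t.
Proof.
by move=> tT dg; apply: cvg_trans dg; apply: cvg_app; exact: at_left_within.
Qed.

(** First-order condition at a maximum of [expR (- K * s) * d s], where only
    the times before [t] are looked at, so that the final time [T] is allowed.
    The maximality bounds [d] from above by the exponential through
    [(t, d t)] with rate [K]; as [s - t < 0], the left difference quotients
    compare the other way, and the exponential has slope [K * d t]. *)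
Lemma derive_within_exp_max (R : realType) (T K : R) (d : R -> R) (t : R) :
  0 < t <= T -> derivable_within `[0, T] d t ->
  (forall s, 0 <= s <= t -> expR (- K * s) * d s <= expR (- K * t) * d t) ->
  K * d t <= derive_within `[0, T] d t.
Proof.
move=> tT dd dmax.
pose e s : R := expR (K * (s - t)) * d t.
have et : is_derive t 1 e (K * d t).
  rewrite /e; apply: is_derive_eq; rewrite subrr mulr0 expR0.
  by rewrite /GRing.scale /=; ring.
have le_ed : \forall s \near t^'-, diff_quotient e t s <= diff_quotient d t s.
  near=> s; have st : s < t by near: s; exact: nbhs_left_lt.
  have s0 : 0 <= s.
    by near: s; apply: nbhs_left_ge; case/andP: tT.
  rewrite /diff_quotient ler_nM2r ?invr_lt0 ?subr_lt0// lerB//.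
    rewrite -(ler_pM2l (expR_gt0 (- K * s))) (le_trans (dmax _ _)) ?s0 ?(ltW st)//.
    rewrite /e mulrA -expRD le_eqVlt; apply/orP; left; apply/eqP.
    by congr (expR _ * _); ring.
  by rewrite /e subrr mulr0 expR0 mul1r.
apply: ler_cvg_to (derive_within_at_left tT dd) le_ed.
exact: cvg_dnbhs_at_left (cvg_diff_quotient et).
Unshelve. all: by end_near. Qed.

Lemma derive_withinB (R : realType) (T : R) (g h : R -> R) (t : R) :
  0 < T -> 0 <= t <= T ->
  derivable_within `[0, T] g t -> derivable_within `[0, T] h t ->
  derivable_within `[0, T] (fun s => g s - h s) t /\
  derive_within `[0, T] (fun s => g s - h s) t =
    derive_within `[0, T] g t - derive_within `[0, T] h t.
Proof.
move=> T0 tT dg dh; have PF := within_itv_proper T0 tT.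
have gh : diff_quotient (fun s => g s - h s) t s @[s --> within `[0, T] t^'] -->
    derive_within `[0, T] g t - derive_within `[0, T] h t.
  rewrite (_ : diff_quotient _ t = diff_quotient g t \- diff_quotient h t).
    exact: cvgB.
  by apply/funext => s; rewrite /diff_quotient/= -mulrBl; congr (_ / _); ring.
by split; [apply: cvgP gh | exact: cvg_lim gh].
Qed.

(** * Clamping to an interval *)

Definition clamp (R : realType) (a b x : R) : R := Num.max a (Num.min b x).

Lemma clamp_itv (R : realType) (a b x : R) : a <= b -> a <= clamp a b x <= b.
Proof. by move=> ab; rewrite /clamp le_max lexx/= ge_max ab ge_min lexx. Qed.

Lemma clamp_id (R : realType) (a b x : R) : a <= x <= b -> clamp a b x = x.
Proof. by move=> /andP[ax xb]; rewrite /clamp min_r// max_r. Qed.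

Lemma continuous_clamp (R : realType) (a b t : R) : {for t, continuous (clamp a b)}.
Proof.
apply: continuous_max; first exact: cvg_cst.
by apply: continuous_min; [exact: cvg_cst | exact: cvg_id].
Qed.

Lemma clamp_lipschitz (R : realType) (a b x y : R) :
  `|clamp a b x - clamp a b y| <= `|x - y|.
Proof.
wlog xy : x y / x <= y.
  by move=> H; have [/H//|/ltW/H] := leP x y; rewrite distrC [leRHS]distrC.
rewrite distrC [leRHS]distrC [leRHS]ger0_norm ?subr_ge0//.
rewrite ler_norml /clamp /Num.max /Num.min.
by do !case: ifPn; rewrite -?leNgt => *; apply/andP; split; lra.
Qed.

(** * The comparison principle *)

Lemma laplacianB (R : realType) (V : finType) (G : connected_weighted_graph R V)
    (a b : V -> R) (x : V) :
  laplacian G (fun y => a y - b y) x = laplacian G a x - laplacian G b x.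
Proof.
rewrite /laplacian -sumrB; apply: eq_bigr => y _.
by rewrite -mulrBl; congr (_ * _); ring.
Qed.

Lemma laplacian_max_le0 (R : realType) (V : finType)
    (G : connected_weighted_graph R V) (a : V -> R) (x : V) :
  (forall y, a y <= a x) -> laplacian G a x <= 0.
Proof.
move=> amax; apply: sumr_le0 => y _; apply: mulr_le0_ge0.
  by rewrite subr_le0.
by rewrite divr_ge0 ?weight_ge0// ltW// vmeasure_gt0.
Qed.

Lemma max_attained (R : realType) (V : finType) (T : R) (h : V -> R -> R) (x0 : V) :
  0 <= T -> (forall x, {within `[0, T], continuous (h x)}) ->
  exists x t, 0 <= t <= T /\ forall y s, 0 <= s <= T -> h y s <= h x t.
Proof.
move=> T0 hc; have /choice[c cP] (x : V) : exists c,
    0 <= c <= T /\ forall t, 0 <= t <= T -> h x t <= h x c.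
  have [c cT cmax] := EVT_max T0 (hc x).
  by exists c; rewrite in_itv/= in cT; split=> // t tT; apply: cmax; rewrite in_itv.
have [x _ xmax] := @Order.TotalTheory.arg_maxP _ R V x0 predT
  (fun x => h x (c x)) isT.
exists x, (c x); split=> [|y s sT]; first by case: (cP x).
exact: le_trans ((cP y).2 s sT) (xmax y isT).
Qed.

Lemma C1_continuous (R : realType) (V : Type) (I : set R) (u : V -> R -> R) (x : V) :
  C1 I u -> {within I, continuous (u x)}.
Proof. by move=> /(_ x)[du _]; exact: Defs.derivable_within_continuous. Qed.

(** Maximum principle. Suppose [v - w] is positive somewhere, and look at the
    point where [expR (- K * t) * (v - w)] is maximal. There the Laplacian of
    [v - w] is nonpositive, so the differential inequalities and the one-sided
    Lipschitz bound give a time derivative of at most [M * (v - w)], while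
    maximality in time gives at least [K * (v - w)]. Any [K > M] makes the two
    incompatible. *)
Lemma lower_le_upper (R : realType) (V : finType)
    (G : connected_weighted_graph R V) (T M : R) (f : V -> R -> R -> R)
    (u0 : V -> R) (v w : V -> R -> R) :
  0 < T ->
  (forall x (t : R), 0 < t <= T -> w x t < v x t ->
    f x t (v x t) - f x t (w x t) <= M * (v x t - w x t)) ->
  lower_solution G T f u0 v -> upper_solution G T f u0 w ->
  forall x (t : R), 0 <= t <= T -> v x t <= w x t.
Proof.
move=> T0 fM [vC1 vle v0] [wC1 wge w0] x t tT.
pose d y s := v y s - w y s.
pose K := M + 1.
have dc y : {within `[0, T], continuous (d y)}.
  have vc := C1_continuous vC1 (x := y); have wc := C1_continuous wC1 (x := y).
  by move=> s; apply: (@cvgB R R^o (subspace `[0, T])); [exact: vc | exact: wc].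
have hc y : {within `[0, T], continuous (fun s => expR (- K * s) * d y s)}.
  move=> s; apply: (@cvgM R (subspace `[0, T])); last exact: dc.
  apply: (@continuous_subspaceT _ _ _ (fun r => expR (- K * r))) => r.
  apply: continuous_comp; last exact: continuous_expR.
  exact: mulrl_continuous.
have [y [s [sT hmax]]] := max_attained x (ltW T0) hc.
have [dle0|dgt0] := leP (d y s) 0.
  have : expR (- K * t) * d x t <= 0.
    by apply: (le_trans (hmax x t tT)); rewrite pmulr_rle0 ?expR_gt0.
  by rewrite pmulr_rle0 ?expR_gt0// subr_le0.
have s0 : 0 < s.
  rewrite lt_neqAle (andP sT).1 andbT; apply/eqP => s0.
  move: dgt0; rewrite -s0 /d subr_gt0 ltNge => /negP; apply.
  exact: le_trans (v0 y) (w0 y).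
have s0T : 0 < s <= T by rewrite s0; case/andP: sT.
have sI : [set` `[0, T]] s by rewrite /= in_itv.
have [dd dE] := derive_withinB T0 sT ((vC1 y).1 s sI) ((wC1 y).1 s sI).
have Kd : K * d y s <= derive_within `[0, T] (d y) s.
  apply: derive_within_exp_max s0T dd _ => r /andP[r0 rs].
  by apply: (hmax y r); rewrite r0 (le_trans rs)//; case/andP: sT.
have := laplacian_max_le0 G (a := d ^~ s) (x := y).
rewrite laplacianB => Ld.
have {Ld}Ld : laplacian G (v^~ s) y - laplacian G (w^~ s) y <= 0.
  by apply: Ld => z; have := hmax z s sT; rewrite ler_pM2l ?expR_gt0.
have := vle y s s0T; have := wge y s s0T; rewrite /heat_op.
have := fM y s s0T; rewrite -subr_gt0 => /(_ dgt0).
move: Kd; rewrite dE /K mulrDl mul1r -/(d y s) => Kd H1 H2 H3.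
move: dgt0 Kd H1 H2 H3 Ld; lra.
Qed.

(** * Tools for successive approximation *)

(** The primitive is taken from [-2] and frozen before [-1], which makes it
    continuous on the whole line and differentiable in the two-sided sense at
    every nonnegative time, including [0]. *)
Lemma antiderivative (R : realType) (h : R -> R) (c : R) :
  continuous h -> exists F : R -> R,
    [/\ continuous F, F 0 = c & forall t : R, 0 <= t -> is_derive t 1 F (h t)].
Proof.
move=> hc.
pose H (x : R) : R := (\int[lebesgue_measure]_(s in `[(-2), x]) h s)%R.
have HP (t : R) : -2 < t -> is_derive t 1 H (h t).
  move=> t2; have [|||dH HE] := @continuous_FTC1_closed R h (-2) t (t + 1) _ _ t2.
  - by rewrite ltrDl.
  - apply: continuous_compact_integrable; first exact: segment_compact.
    exact: continuous_subspaceT.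
  - exact: hc.
  by apply: DeriveDef; [exact: dH | rewrite -derive1E; exact: HE].
exists (fun t => H (Num.max t (-1)) - H 0 + c); split.
- move=> t; apply: cvgD; last exact: cvg_cst.
  apply: cvgB; last exact: cvg_cst.
  apply: (@continuous_comp _ _ _ (fun s : R => Num.max s (-1)) H).
    by apply: continuous_max; [exact: cvg_id | exact: cvg_cst].
  apply: differentiable_continuous; apply/derivable1_diffP.
  have [] // := HP (Num.max t (-1)).
  by rewrite lt_max; apply/orP; right; lra.
- by rewrite max_l ?subrr ?add0r//; lra.
- move=> t t0; have Ht : is_derive t 1 (fun s => H s - H 0 + c) (h t).
    have -> : (fun s => H s - H 0 + c) = H + cst (- H 0 + c).
      by apply/funext => s; rewrite addrA.
    have := HP t; rewrite (lt_le_trans _ t0)// => /(_ isT) ?.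
    by apply: is_derive_eq; rewrite addr0.
  apply: near_eq_is_derive Ht => //; near=> s.
  rewrite max_l//; near: s; apply: lt_le_nbhsr; lra.
Unshelve. all: by end_near. Qed.

(** The steps are summable uniformly in [t], so the sequence is Cauchy in the
    complete space of functions with the uniform topology. *)
Lemma geometric_uniform_limit (R : realType) (C : R) (g : nat -> R -> R) :
  (forall n, continuous (g n)) ->
  (forall n t, `|g n.+1 t - g n t| <= C / 2 ^+ n) ->
  exists l : R -> R, continuous l /\
    forall e : R, 0 < e -> \forall n \near \oo, forall t, `|l t - g n t| < e.
Proof.
move=> gc gC.
(* The remainder of the geometric series, telescoped to ease the induction. *)
have tail n k t : `|g (n + k)%N t - g n t| <= 2 * C / 2 ^+ n - 2 * C / 2 ^+ (n + k).
  elim: k => [|k IH]; first by rewrite addn0 !subrr normr0.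
  rewrite addnS (le_trans (ler_distD (g (n + k)%N t) _ _))//.
  apply: (le_trans (lerD (gC _ _) IH)); rewrite exprS le_eqVlt; apply/orP; left.
  have p0 : 2 ^+ (n + k) != 0 :> R by rewrite expf_neq0.
  by apply/eqP; rewrite -!mulrA invfM; set p := (2 ^+ (n + k))^-1; field.
have C0 : 0 <= C by have := le_trans (normr_ge0 _) (gC 0%N 0); rewrite expr0 divr1.
pose h : nat -> arrow_uniform_type R R^o := g.
have hcvg : cvg (h @ \oo).
  apply/cauchy_cvgP/cauchy_ballP => e e0; near_simpl.
  suff : \forall n & m \near \oo, (m <= n)%N -> ball (h n) e (h m).
    move=> /[dup]; rewrite {1}near_swap; apply: filter_app2; near=> n m.
    by have /orP[mn /(_ mn)/ball_sym + _| ? _] := leq_total n m; apply.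
  near=> n m => /= mn t; rewrite /ball/= /h -(subnKC mn).
  apply: (le_lt_trans (tail m _ t)).
  apply: (@le_lt_trans _ _ (geometric (2 * C) 2^-1 m)).
    rewrite /geometric/= exprVn lerBlDr lerDl divr_ge0 ?exprn_ge0//.
    exact: mulr_ge0.
  rewrite -[X in X < _]ger0_norm ?/geometric/=; last first.
    by rewrite mulr_ge0 ?exprn_ge0// mulr_ge0.
  near: m; near_simpl; move: e e0.
  apply: (cvgr0_norm_lt (fun _ => _ : R^o)); apply: cvg_geometric.
  by rewrite ger0_norm// invf_lt1// ltr1n.
exists (lim (h @ \oo)); split.
  apply: (@uniform_limit_continuous _ _ (h @ \oo) (lim (h @ \oo))).
    by near_simpl; apply: nearW; exact: gc.
  by move=> A; rewrite /= uniform_nbhsT; exact: hcvg.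
move=> e e0; have /cvg_ballP/(_ e e0) := hcvg.
by apply: filterS => n + t => /(_ t).
Unshelve. all: by end_near. Qed.

(** [c * expR (a * t)] starts at [c >= 0], above [g], and grows at least as
    fast, so the difference stays nonnegative by the mean value theorem. *)
Lemma le_expR_of_derive (R : realType) (a c T : R) (g dg : R -> R) :
  0 <= c -> g 0 = 0 -> continuous g ->
  (forall t : R, 0 < t < T -> is_derive t 1 g (dg t)) ->
  (forall t, 0 < t < T -> dg t <= a * c * expR (a * t)) ->
  forall t, 0 <= t <= T -> g t <= c * expR (a * t).
Proof.
move=> c0 g0 gc gd dgle t /andP[t0 tT].
pose k s : R := c * expR (a * s) - g s.
have kd s : s \in `]0, t[ -> is_derive s 1 k (a * c * expR (a * s) - dg s).
  rewrite in_itv/= => /andP[s0 st].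
  have ? : is_derive s 1 g (dg s) by apply: gd; rewrite s0 (lt_le_trans st).
  by rewrite /k; apply: is_derive_eq; rewrite /GRing.scale/=; ring.
have kc : {within `[0, t], continuous k}.
  apply: continuous_subspaceT => s; apply: cvgB; last exact: gc.
  apply: cvgM; first exact: cvg_cst.
  by apply: continuous_comp; [exact: mulrl_continuous | exact: continuous_expR].
have [t_eq0|t_neq0] := eqVneq t 0.
  by rewrite t_eq0 g0 mulr0 expR0 mulr1.
have {t_neq0}t0 : 0 < t by rewrite lt_neqAle eq_sym t_neq0.
have [s] := MVT t0 kd kc; rewrite in_itv/= => /andP[s0 st].
rewrite /k g0 mulr0 expR0 mulr1 subr0 => kE.
rewrite -subr_ge0 -[leRHS](subrK c) addr_ge0// kE mulr_ge0//; last by rewrite subr0 ltW.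
by rewrite subr_ge0 dgle// s0 (lt_le_trans st).
Qed.

Lemma norm_le_expR_of_derive (R : realType) (a c T : R) (g dg : R -> R) :
  0 <= c -> g 0 = 0 -> continuous g ->
  (forall t : R, 0 < t < T -> is_derive t 1 g (dg t)) ->
  (forall t, 0 < t < T -> `|dg t| <= a * c * expR (a * t)) ->
  forall t, 0 <= t <= T -> `|g t| <= c * expR (a * t).
Proof.
move=> c0 g0 gc gd dgle t tT; rewrite ler_norml lerNl; apply/andP; split.
  apply: (@le_expR_of_derive R a c T (- g) (- dg)) => //.
  - by rewrite -[LHS]/(- g 0) g0 oppr0.
  - by move=> s; apply: cvgN; exact: gc.
  - by move=> s sT; have ? := gd s sT; exact: is_deriveN.
  - by move=> s sT; rewrite (le_trans (ler_norm _))// normrN dgle.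
apply: (@le_expR_of_derive R a c T g dg) => // s sT.
by rewrite (le_trans (ler_norm _))// dgle.
Qed.

(** * Global existence for Lipschitz systems *)

(** Successive approximations measured in the weighted norm
    [sup |u x t| * expR (- 2 * L * t)]: integrating an error [c * expR (2 L t)]
    amplified by [L] yields [c / 2 * expR (2 L t)], so the Picard map contracts
    by [1/2] on all of [0, T] at once and no gluing of short-time solutions is
    needed. The right-hand side enters only through superposition with
    continuous functions, which spares a topology on [V -> R]; the Lipschitz
    bound is used only at interior times, since it serves to compare functions
    with equal values at time [0] through their derivatives. *)
Lemma picard (R : realType) (V : finType) (T L : R)
    (H : V -> R -> (V -> R) -> R) (u0 : V -> R) :
  0 <= T -> 0 < L ->
  (forall u : V -> R -> R, (forall x, continuous (u x)) ->
    forall x, continuous (fun t => H x t (u^~ t))) ->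
  (forall x t a b c, 0 < t < T -> (forall y, `|a y - b y| <= c) ->
    `|H x t a - H x t b| <= L * c) ->
  exists u : V -> R -> R,
    [/\ forall x, continuous (u x), forall x, u x 0 = u0 x
      & forall x (t : R), 0 <= t <= T -> is_derive t 1 (u x) (H x t (u^~ t))].
Proof.
move=> T0 L0 Hc HL.
have /choice[Phi PhiP] (u : V -> R -> R) : exists F : V -> R -> R,
    (forall x, continuous (u x)) -> forall x, [/\ continuous (F x), F x 0 = u0 x
      & forall t : R, 0 <= t -> is_derive t 1 (F x) (H x t (u^~ t))].
  have [uc|] := pselect (forall x, continuous (u x)); last by exists u.
  have /choice[F FP] x := antiderivative (u0 x) (Hc u uc x).
  by exists F.
(* Phi is the Picard map: it halves distances in the weighted norm. *)
have contract (u v : V -> R -> R) (c : R) : 0 <= c ->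
    (forall x, continuous (u x)) -> (forall x, continuous (v x)) ->
    (forall x t, 0 <= t <= T -> `|u x t - v x t| <= c * expR (2 * L * t)) ->
    forall x t, 0 <= t <= T ->
      `|Phi u x t - Phi v x t| <= c / 2 * expR (2 * L * t).
  move=> c0 uc vc uv x.
  have [Fuc Fu0 Fud] := PhiP u uc x; have [Fvc Fv0 Fvd] := PhiP v vc x.
  apply: (norm_le_expR_of_derive
    (dg := fun t => H x t (u^~ t) - H x t (v^~ t))).
  - by rewrite divr_ge0.
  - by rewrite Fu0 Fv0 subrr.
  - by move=> t; apply: cvgB; [exact: Fuc | exact: Fvc].
  - move=> t /andP[/ltW t0 _].
    by have := Fud t t0; have := Fvd t t0; move=> ? ?; exact: is_deriveB.
  - move=> t tT; rewrite (_ : 2 * L * (c / 2) = L * c); last by field.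
    rewrite -mulrA; apply: HL => // y; apply: uv.
    by case/andP: tT => /ltW-> /ltW.
pose U n := iter n Phi (fun x _ => u0 x).
have Uc n x : continuous (U n x).
  elim: n x => [|n IH] x; first by move=> t; exact: cvg_cst.
  by case: (PhiP _ IH x).
have [B B0 UB] : exists2 B, 0 <= B &
    forall x t, 0 <= t <= T -> `|U 1%N x t - U 0%N x t| <= B * expR (2 * L * t).
  have /choice[b bP] (x : V) : exists b, forall t, 0 <= t <= T ->
      `|U 1%N x t - U 0%N x t| <= b.
    have [|c _ cmax] := @EVT_max R (fun t => `|U 1%N x t - U 0%N x t|) 0 T T0.
      apply: continuous_subspaceT => t; apply: cvg_norm.
      by apply: cvgB; exact: Uc.
    by exists `|U 1%N x c - U 0%N x c| => t tT; apply: cmax; rewrite in_itv.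
  exists (\sum_x `|b x|); first exact: sumr_ge0.
  move=> x t tT; apply: (le_trans (bP x t tT)).
  apply: (@le_trans _ _ (\sum_x `|b x|)).
    by rewrite (bigD1 x)//= (le_trans (ler_norm _))// lerDl sumr_ge0.
  rewrite ler_peMr ?sumr_ge0// -expR0 ler_expR.
  by rewrite !mulr_ge0 ?(ltW L0)//; case/andP: tT.
have UU n x t : 0 <= t <= T ->
    `|U n.+1 x t - U n x t| <= B / 2 ^+ n * expR (2 * L * t).
  elim: n x t => [|n IH] x t tT; first by rewrite expr0 divr1 UB.
  rewrite (_ : B / 2 ^+ n.+1 = B / 2 ^+ n / 2); last first.
    by rewrite exprS invfM mulrA mulrAC.
  by apply: (contract (U n.+1) (U n)) => //; rewrite divr_ge0 ?exprn_ge0.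
pose E := expR (2 * L * T).
have expE t : 0 <= t <= T -> expR (2 * L * t) <= E.
  by move=> /andP[_ tT]; rewrite ler_expR ler_wpM2l// mulr_ge0// ltW.
(* Estimates hold on [0, T] only; precomposing with the clamp turns them into
   estimates on the whole line, where uniform limits are taken. *)
pose cl := clamp 0 T.
have clE t : 0 <= t <= T -> cl t = t by exact: clamp_id.
have /choice[u uP] x : exists l : R -> R, continuous l /\
    forall e : R, 0 < e -> \forall n \near \oo, forall t, `|l t - U n x (cl t)| < e.
  apply: (@geometric_uniform_limit R (B * E) (fun n t => U n x (cl t))).
    move=> n t; apply: (@continuous_comp _ _ _ cl (U n x)); last exact: Uc.
    exact: continuous_clamp.
  move=> n t; apply: (le_trans (UU n x (cl t) (clamp_itv t T0))).
  by rewrite mulrAC ler_wpM2r ?invr_ge0 ?exprn_ge0// ler_wpM2l// expE// clamp_itv.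
have uc x : continuous (u x) by case: (uP x).
have uU e : 0 < e -> \forall n \near \oo, forall x t, 0 <= t <= T ->
    `|u x t - U n x t| < e.
  move=> e0; have : \forall n \near \oo, forall x, forall t, `|u x t - U n x (cl t)| < e.
    by apply: filter_forall => x; exact: (uP x).2.
  by apply: filterS => n H1 x t tT; have := H1 x t; rewrite clE.
(* The limit is a fixed point: it and its image are both limits of U. *)
have uPhi x t : 0 <= t <= T -> u x t = Phi u x t.
  move=> tT; apply/eqP; rewrite -subr_eq0 -normr_le0; apply/ler_addgt0Pl => e e0.
  rewrite addr0.
  pose r := e / (1 + E).
  have E1 : 0 < 1 + E by rewrite addr_gt0// expR_gt0.
  have r0 : 0 < r by rewrite divr_gt0.
  near \oo => n.
  have h0 y s : 0 <= s <= T -> `|u y s - U n y s| < r.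
    by move: y s; near: n; exact: uU.
  have h1 y s : 0 <= s <= T -> `|u y s - U n.+1 y s| < r.
    move: y s; near: n; have [N _ NP] := uU _ r0; exists N => // n /= Nn.
    exact: (NP n.+1 (leqW Nn)).
  have h2 : `|U n.+1 x t - Phi u x t| <= r * E.
    apply: (@le_trans _ _ (r / 2 * expR (2 * L * t))).
      apply: (contract (U n)) => //; first exact: ltW.
      move=> y s sT; rewrite distrC (le_trans (ltW (h0 _ _ sT)))//.
      rewrite ler_peMr ?(ltW r0)// -expR0 ler_expR.
      by rewrite !mulr_ge0 ?(ltW L0)//; case/andP: sT.
    by apply: ler_pM; rewrite ?expR_ge0 ?expE ?divr_ge0 ?(ltW r0)//; lra.
  rewrite (le_trans (ler_distD (U n.+1 x t) _ _))//.
  apply: (le_trans (lerD (ltW (h1 _ _ tT)) h2)).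
  by rewrite -{1}[r]mulr1 -mulrDr /r divfK// gt_eqF.
(* u is frozen outside [0, T], so it may have kinks at the endpoints; Phi u
   takes the same values on [0, T] and has two-sided derivatives there. *)
exists (Phi u); split=> [x|x|x t tT]; [by case: (PhiP u uc x)..|].
have -> : (Phi u)^~ t = u^~ t by apply/funext => y; rewrite uPhi.
by case: (PhiP u uc x) => _ _; apply; case/andP: tT.
Unshelve. all: by end_near. Qed.

(** * Existence for a globally Lipschitz nonlinearity *)

(** Composing with a map into [A] turns continuity along [A] into ordinary
    continuity; this is how the clamped [f] becomes continuous everywhere. *)
Lemma continuous_within_comp (R : realType) (U : topologicalType) (A : set U)
    (h : U -> R) (g : R -> U) :
  {within A, continuous h} -> continuous g -> (forall t, A (g t)) ->
  continuous (h \o g).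
Proof.
move=> /subspace_continuousP hc gc Ag t.
apply: (cvg_comp _ _ _ (hc _ (Ag t))).
move=> B hB; have : \forall s \near t, A (g s) -> B (g s) by exact: gc hB.
by apply: filterS => s; apply; exact: Ag.
Qed.

Lemma laplacian_lipschitz (R : realType) (V : finType)
    (G : connected_weighted_graph R V) :
  exists2 L, 0 <= L & forall (a b : V -> R) c x, (forall y, `|a y - b y| <= c) ->
    `|laplacian G a x - laplacian G b x| <= L * c.
Proof.
pose q x y := weight G y x / vmeasure G x.
have q0 x y : 0 <= q x y.
  by rewrite divr_ge0 ?weight_ge0// ltW// vmeasure_gt0.
exists (\sum_x \sum_y 2 * q x y) => [|a b c x ab].
  by apply: sumr_ge0 => x _; apply: sumr_ge0 => y _; exact: mulr_ge0.
have c0 : 0 <= c := le_trans (normr_ge0 _) (ab x).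
apply: (@le_trans _ _ ((\sum_y 2 * q x y) * c)); last first.
  apply: ler_wpM2r => //; rewrite [leRHS](bigD1 x)//= lerDl.
  by apply: sumr_ge0 => z _; apply: sumr_ge0 => y _; exact: mulr_ge0.
rewrite -laplacianB mulr_suml (le_trans (ler_norm_sum _ _ _))//.
apply: ler_sum => y _; rewrite normrM [`|q x y|]ger0_norm// mulrAC.
apply: ler_wpM2r => //; rewrite (le_trans (ler_normB _ _))//.
by rewrite mulr_natl mulr2n lerD.
Qed.

Lemma exists_solution (R : realType) (V : finType)
    (G : connected_weighted_graph R V) (T M : R) (f : V -> R -> R -> R)
    (u0 : V -> R) :
  0 < T -> 0 <= M ->
  (forall x (g : R -> R), continuous g -> continuous (fun t => f x t (g t))) ->
  (forall x t a b, 0 < t < T -> `|f x t a - f x t b| <= M * `|a - b|) ->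
  exists u, solution G T f u0 u.
Proof.
move=> T0 M0 fc fM; have [L L0 GL] := laplacian_lipschitz G.
pose H x t (a : V -> R) := laplacian G a x + f x t (a x).
have Hc (u : V -> R -> R) : (forall x, continuous (u x)) ->
    forall x, continuous (fun t => H x t (u^~ t)).
  move=> uc x t; apply: cvgD; last exact: (fc x (u x) (uc x)).
  rewrite /laplacian; apply: cvg_big => [|y _]; first exact: add_continuous.
  apply: cvgM; last exact: cvg_cst.
  by apply: cvgB; exact: uc.
have [||u [uc u00 ud]] := @picard R V T (L + M + 1) H u0 (ltW T0) _ Hc.
- by rewrite ltr_pwDr// addr_ge0.
- move=> x t a b c tT ab; rewrite /H opprD addrACA (le_trans (ler_normD _ _))//.
  have c0 : 0 <= c := le_trans (normr_ge0 _) (ab x).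
  rewrite -addrA mulrDl lerD ?GL// (le_trans (fM _ _ _ _ tT))//.
  by apply: ler_pM => //; lra.
have du x t : 0 <= t <= T -> derivable_within `[0, T] (u x) t /\
    derive_within `[0, T] (u x) t = H x t (u^~ t).
  by move=> tT; apply: is_derive_within => //; exact: ud.
exists u; split=> // [x|x t /andP[t0 tT]]; last first.
  by rewrite /heat_op (du x t _).2 ?(ltW t0)// /H addrC addKr.
split=> [t /=|]; first by rewrite in_itv/= => /(du x t)[].
apply: (@subspace_eq_continuous _ _ _ (fun t => H x t (u^~ t))).
  by move=> t; rewrite inE/= in_itv/= => /(du x t)[_ duE]; exact: esym duE.
exact/continuous_subspaceT/Hc.
Qed.

(** * Existence and uniqueness between the barriers *)

Lemma eta_bounds (R : realType) (V : finType) (T : R) (v w : V -> R -> R) :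
  0 <= T -> C1 `[0, T] v -> C1 `[0, T] w ->
  forall x (t : R), 0 <= t <= T ->
    eta_min T v w <= v x t <= eta_max T v w /\
    eta_min T v w <= w x t <= eta_max T v w.
Proof.
move=> T0 vC1 wC1 x t tT.
have vc y := C1_continuous vC1 (x := y); have wc y := C1_continuous wC1 (x := y).
have [|y [s [_ hmin]]] :=
    @max_attained R V T (fun y s => - Num.min (v y s) (w y s)) x T0.
  move=> y s; apply: cvgN; apply: (@continuous_min R (subspace `[0, T]));
    [exact: vc | exact: wc].
have [|z [r [_ hmax]]] :=
    @max_attained R V T (fun y s => Num.max (v y s) (w y s)) x T0.
  move=> z r; apply: (@continuous_max R (subspace `[0, T]));
    [exact: vc | exact: wc].
have etam : eta_min T v w <= Num.min (v x t) (w x t).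
  apply: ge_inf; last by exists (x, t) => //; split => //=; rewrite in_itv.
  exists (Num.min (v y s) (w y s)) => _ [[y' s'] [_ /= sI] <-].
  by rewrite -lerN2 hmin//; move: sI; rewrite in_itv.
have etaM : Num.max (v x t) (w x t) <= eta_max T v w.
  apply: ub_le_sup; last by exists (x, t) => //; split => //=; rewrite in_itv.
  exists (Num.max (v z r) (w z r)) => _ [[y' s'] [_ /= sI] <-].
  by rewrite hmax//; move: sI; rewrite in_itv.
move: etam etaM; rewrite le_min ge_max => /andP[-> ->] /andP[-> ->].
by [].
Qed.

Theorem theorem4p4 (R : realType) (V : finType) (G : connected_weighted_graph R V)
    (T : R) (T_gt0 : 0 < T) (f : V -> R -> R -> R) (u0 : V -> R)
    (uu lu : V -> R -> R)
    (uu_upper : upper_solution G T f u0 uu)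
    (lu_lower : lower_solution G T f u0 lu)
    (f_cont : forall x : V,
      {within `[0, T] `*` `[eta_min T uu lu, eta_max T uu lu],
        continuous (fun p : R * R => f x p.1 p.2)})
    (M : R) (M_gt0 : 0 < M)
    (f_lip : forall (x : V) (t a b : R), 0 < t <= T ->
      a \in `[eta_min T uu lu, eta_max T uu lu] ->
      b \in `[eta_min T uu lu, eta_max T uu lu] ->
      `|f x t a - f x t b| <= M * `|a - b|) :
  exists u : V -> R -> R,
    [/\ solution G T f u0 u,
        forall x t, 0 <= t <= T -> lu x t <= u x t <= uu x t
      & forall v : V -> R -> R, solution G T f u0 v ->
          (forall x t, 0 <= t <= T -> lu x t <= v x t <= uu x t) ->
          forall x t, 0 <= t <= T -> v x t = u x t].
Proof.
(* Every claim is vacuous without vertices; a vertex witnesses [m <= k]. *)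
have [V0|/card_gt0P[x0 _]] := posnP #|V|.
  have noV (x : V) : False by have := fintype0 x V0.
  by exists (fun _ _ => 0); split=> [|x|v _ _ x]; [split=> x|..]; case: (noV x).
move: f_cont f_lip; set m := eta_min T uu lu; set k := eta_max T uu lu.
move=> f_cont f_lip.
have T0 := ltW T_gt0.
have [uuC1 uu_ge uu0] := uu_upper; have [luC1 lu_le lu0] := lu_lower.
have etaB := eta_bounds T0 uuC1 luC1.
have mk : m <= k.
  by have [|/andP[mu uk] _] := etaB x0 0; [rewrite lexx | exact: le_trans mu uk].
pose F x t z := f x (clamp 0 T t) (clamp m k z).
have FE x t z : 0 <= t <= T -> m <= z <= k -> F x t z = f x t z.
  by move=> tT zmk; rewrite /F !clamp_id.
have FM x t a b : 0 < t <= T -> `|F x t a - F x t b| <= M * `|a - b|.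
  move=> /[dup] tT /andP[/ltW t0 tT']; rewrite /F clamp_id ?t0//.
  rewrite (le_trans (f_lip x t _ _ tT _ _)) ?in_itv/= ?clamp_itv//.
  by rewrite ler_wpM2l ?(ltW M_gt0)// clamp_lipschitz.
have Fc x (g : R -> R) : continuous g -> continuous (fun t => F x t (g t)).
  move=> gc; apply: (continuous_within_comp (f_cont x)
      (g := fun t => (clamp 0 T t, clamp m k (g t)))).
    move=> t.
    have gt : clamp m k (g s) @[s --> t] --> clamp m k (g t).
      apply: (@continuous_comp _ _ _ g (clamp m k)); first exact: gc.
      exact: continuous_clamp.
    exact: cvg_pair (@continuous_clamp R 0 T t) gt.
  by move=> t; split; rewrite /= in_itv/= clamp_itv.
(* f itself is Lipschitz only on [m, k], so comparison is made for F. *)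
have compF v w : lower_solution G T F u0 v -> upper_solution G T F u0 w ->
    forall x t, 0 <= t <= T -> v x t <= w x t.
  apply: (@lower_le_upper _ _ _ _ M) => // x t tT wv.
  rewrite (le_trans (ler_norm _))// (le_trans (FM _ _ _ _ tT))//.
  by rewrite ger0_norm// subr_ge0 ltW.
have tT' t : 0 < t <= T -> 0 <= t <= T by move=> /andP[/ltW-> ->].
have uuF : upper_solution G T F u0 uu.
  by split=> // x t tT; rewrite FE ?uu_ge ?tT'//; case: (etaB x t (tT' _ tT)).
have luF : lower_solution G T F u0 lu.
  by split=> // x t tT; rewrite FE ?lu_le ?tT'//; case: (etaB x t (tT' _ tT)).
have sol_lower v : solution G T F u0 v -> lower_solution G T F u0 v.
  by move=> [? ve v0]; split=> // x => [t tT|]; rewrite ?ve ?v0.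
have sol_upper v : solution G T F u0 v -> upper_solution G T F u0 v.
  by move=> [? ve v0]; split=> // x => [t tT|]; rewrite ?ve ?v0.
have between v x t : 0 <= t <= T -> lu x t <= v x t <= uu x t -> m <= v x t <= k.
  move=> tT /andP[luv vuu]; have [/andP[_ uuk] /andP[mlu _]] := etaB x t tT.
  by rewrite (le_trans mlu luv) (le_trans vuu uuk).
have [u uF] : exists u, solution G T F u0 u.
  apply: (@exists_solution _ _ _ _ M) => //; first exact: ltW.
  by move=> x t a b /andP[t0 tT]; apply: FM; rewrite t0 ltW.
have luu x t : 0 <= t <= T -> lu x t <= u x t <= uu x t.
  have [ul uup] := (sol_lower u uF, sol_upper u uF).
  by move=> tT; apply/andP; split; apply: compF.
exists u; split=> //.
  case: uF => uC1 ue u00; split=> // x t tT; rewrite ue// FE ?tT'//.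
  by apply: between; [exact: tT' | exact/luu/tT'].
move=> v [vC1 ve v0] vb x t tT.
have vF : solution G T F u0 v.
  split=> // y s sT; rewrite ve// FE ?tT'//.
  by apply: between; [exact: tT' | exact/vb/tT'].
apply/le_anti/andP; split; apply: compF => //;
  by [exact: sol_lower | exact: sol_upper].
Qed.
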